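(* In the LQG setting of the context, including the observability/controllability assumption on the controller, the estimation matrix $$L_{\rm est}=\begin{bmatrix}F_u-(a\otimes I_n)\tilde M_u & F_y-(a\otimes I_n)\tilde M_y\\ a\otimes I_m&0\end{bmatrix}\in\mathbb R^{(n+m)\times n(m+l)}$$ has full row rank, i.e. $\operatorname{Rank}(L_{\rm est})=n+m$.
   Context: System: $x(t+1)=Ax(t)+Bu(t)+w(t)$, $y(t)=Cx(t)+v(t)$, with $x(t)\in\mathbb R^n$, $u(t)\in\mathbb R^m$, $y(t)\in\mathbb R^l$, and independent white noises $w(t)\sim\mathcal N(0,W)$, $v(t)\sim\mathcal N(0,V)$, $W\succeq0$, $V\succ0$. $(A,B)$ and $(A,W^{1/2})$ are controllable, $(A,C)$ is observable. Cost matrices $Q\succeq0$, $R\succ0$ with $(A,Q^{1/2})$ observable. Controller matrices: $E=(I-L_{\rm f}C)A$, $F=(I-L_{\rm f}C)B$, $G=L_{\rm f}$. Here $L_{\rm f}=\Pi C^{\mathsf T}(C\Pi C^{\mathsf T}+V)^{-1}$ is the Kalman gain, with $\Pi\succeq 0$ the stabilizing solution of $\Pi=A\Pi A^{\mathsf T}-A\Pi C^{\mathsf T}(C\Pi C^{\mathsf T}+V)^{-1}C\Pi A^{\mathsf T}+W$, and $K_{\rm LQR}=-(R+B^{\mathsf T}SB)^{-1}B^{\mathsf T}SA$ is the LQR gain, with $S\succeq 0$ the stabilizing solution of $S=A^{\mathsf T}SA-A^{\mathsf T}SB(R+B^{\mathsf T}SB)^{-1}B^{\mathsf T}SA+Q$.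 Standing assumption on the controller: for every $i\in\{1,\dots,m\}$ the pair $(E,K_{{\rm LQR},i})$ is observable, where $K_{{\rm LQR},i}$ is the $i$-th row of $K_{\rm LQR}$, and the pair $(E,L_{\rm f})$ is controllable. Notation: $a=[a_0\ \cdots\ a_{n-1}]$ is such that $E^n=a_0I+a_1E+\cdots+a_{n-1}E^{n-1}$; $F_u=[E^{n-1}F\ \cdots\ EF\ F]$; $F_y=[E^{n-1}G\ \cdots\ EG\ G]$; $\tilde M_u$ (resp. $\tilde M_y$) is the $n\times n$ block matrix with $(i,j)$ block $E^{i-j-1}F$ (resp. $E^{i-j-1}G$) for $i>j$ and $0$ otherwise; $\otimes$ is the Kronecker product. *)

(* Defs.v *)
From mathcomp Require Import all_boot all_order all_algebra.
From mathcomp Require Import spectral complex mxtens reals.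

Set Implicit Arguments.
Unset Strict Implicit.
Unset Printing Implicit Defensive.

Import Order.TTheory GRing.Theory Num.Theory.
Local Open Scope ring_scope.

Definition psdmx (R : realType) n (M : 'M[R]_n) : Prop :=
  M \is symmetricmx /\ forall x : 'cV[R]_n, 0 <= (x^T *m M *m x) 0 0.

Definition pdmx (R : realType) n (M : 'M[R]_n) : Prop :=
  M \is symmetricmx /\
  forall x : 'cV[R]_n, x != 0 -> 0 < (x^T *m M *m x) 0 0.

(* [M] and [N] determine each other when [M] is positive semidefinite, so this
   relation is the graph of [M |-> M^(1/2)]. *)
Definition is_psd_sqrt (R : realType) n (M N : 'M[R]_n) : Prop :=
  psdmx N /\ N *m N = M.

Definition controllable (R : realType) n p (A : 'M[R]_n) (B : 'M[R]_(n, p)) :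
    Prop :=
  \rank (\mxrow_(k < n) (A ^+ k *m B)) = n.

Definition observable (R : realType) n p (A : 'M[R]_n) (C : 'M[R]_(p, n)) :
    Prop :=
  \rank (\mxcol_(k < n) (C *m A ^+ k)) = n.

(* Discrete-time stability: all complex eigenvalues in the open unit disc. *)
Definition schur_stable (R : realType) n (A : 'M[R]_n) : Prop :=
  forall z : R[i], eigenvalue (map_mx (real_complex R) A) z -> `|z| < 1.

Definition kalman_gain (R : realType) n l
    (C : 'M[R]_(l, n)) (V : 'M[R]_l) (Pi : 'M[R]_n) : 'M[R]_(n, l) :=
  Pi *m C^T *m invmx (C *m Pi *m C^T + V).

Definition lqr_gain (R : realType) n m
    (A : 'M[R]_n) (B : 'M[R]_(n, m)) (Ru : 'M[R]_m) (S : 'M[R]_n) :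
    'M[R]_(m, n) :=
  - (invmx (Ru + B^T *m S *m B) *m B^T *m S *m A).

(* "Stabilizing" refers to the closed-loop error matrix [A - A Lf C]. *)
Definition stabilizing_filter_riccati (R : realType) n l
    (A : 'M[R]_n) (C : 'M[R]_(l, n)) (W : 'M[R]_n) (V : 'M[R]_l)
    (Pi : 'M[R]_n) : Prop :=
  [/\ psdmx Pi,
      Pi = A *m Pi *m A^T
           - A *m Pi *m C^T *m invmx (C *m Pi *m C^T + V) *m C *m Pi *m A^T
           + W
    & schur_stable (A - A *m kalman_gain C V Pi *m C)].

(* "Stabilizing" refers to the closed-loop matrix [A + B K]. *)
Definition stabilizing_control_riccati (R : realType) n m
    (A : 'M[R]_n) (B : 'M[R]_(n, m)) (Q : 'M[R]_n) (Ru : 'M[R]_m)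
    (S : 'M[R]_n) : Prop :=
  [/\ psdmx S,
      S = A^T *m S *m A
          - A^T *m S *m B *m invmx (Ru + B^T *m S *m B) *m B^T *m S *m A
          + Q
    & schur_stable (A + B *m lqr_gain A B Ru S)].

Lemma sum_ord_const (n p : nat) : (n * p)%N = (\sum_(j < n) p)%N.
Proof. by rewrite sum_nat_const card_ord. Qed.

(* The Kronecker product [a (x) I_p], with its dimensions [1 * p] and [n * p]
   cast to [p] and to the column count [\sum_(j < n) p] of [\mxrow]. *)
Definition kron_id (R : realType) n (a : 'rV[R]_n) (p : nat) :
    'M[R]_(p, \sum_(j < n) p) :=
  castmx (mul1n p, sum_ord_const n p) (a *t (1%:M : 'M[R]_p)).

(* [[E^(n-1) F, ..., E F, F]] *)
Definition input_row (R : realType) n p (E : 'M[R]_n) (F : 'M[R]_(n, p)) :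
    'M[R]_(n, \sum_(j < n) p) :=
  \mxrow_(j < n) (E ^+ (n - 1 - j) *m F).

(* The strictly lower triangular block Toeplitz matrix of the [E^(i-j-1) F];
   the exponent is unaffected by indexing the blocks from 0. *)
Definition toeplitz_mx (R : realType) n p (E : 'M[R]_n) (F : 'M[R]_(n, p)) :
    'M[R]_(\sum_(i < n) n, \sum_(j < n) p) :=
  \mxblock_(i < n, j < n)
    (if (j < i)%N then E ^+ (i - j - 1) *m F else 0).

Definition est_mx (R : realType) n m l (E : 'M[R]_n) (F : 'M[R]_(n, m))
    (G : 'M[R]_(n, l)) (a : 'rV[R]_n) :
    'M[R]_(n + m, \sum_(j < n) m + \sum_(j < n) l) :=
  block_mx (input_row E F - kron_id a n *m toeplitz_mx E F)
           (input_row E G - kron_id a n *m toeplitz_mx E G)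
           (kron_id a m) 0.

(* Main.v *)
Require Import Defs.
From mathcomp Require Import all_boot all_order all_algebra reals.
From mathcomp Require Import spectral mxtens zify.

Set Implicit Arguments.
Unset Strict Implicit.
Unset Printing Implicit Defensive.

Import Order.TTheory GRing.Theory Num.Theory.
Local Open Scope ring_scope.

(** A row vector [(x, y)] annihilating the estimation matrix satisfies
    [x *m p_j(E) *m G = 0] for monic polynomials [p_j] of degree [n - 1 - j], so
    by descending induction on [j] it annihilates the controllability matrix of
    [(E, Lf)] and [x = 0]. Then [a_j y = 0] for all [j], and it remains to see
    that [a != 0], i.e. that [E] is not nilpotent. In fact [E] is invertible:
    [1 - Lf C] is, because [C (1 - Lf C) = V (C Pi C^T + V)^-1 C], and [A] is,
    because a vector killed by [A] would be killed by both [E] and [K], hence be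
    unobservable. *)

Lemma unitmx_inj (F : fieldType) n (M : 'M[F]_n) :
  (forall x : 'cV_n, M *m x = 0 -> x = 0) -> M \in unitmx.
Proof.
move=> Minj; rewrite -unitmx_tr -row_free_unit; apply: inj_row_free => v vM0.
by apply: trmx_inj; rewrite trmx0; apply: Minj; rewrite -[M]trmxK -trmx_mul vM0 trmx0.
Qed.

Lemma pdmx_unit (R : realType) n (M : 'M[R]_n) : pdmx M -> M \in unitmx.
Proof.
case=> _ Mpos; apply: unitmx_inj => x Mx0; apply/eqP/negPn/negP => /Mpos.
by rewrite -mulmxA Mx0 mulmx0 mxE ltxx.
Qed.

Lemma symmetricmx_tr (R : realType) n (M : 'M[R]_n) :
  reflect (M^T = M) (M \is symmetricmx).
Proof.
(* Symmetric means Hermitian with sign [(-1) ^+ 0] and the identity as conjugation. *)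
rewrite is_hermitianmxE expr0 scale1r map_mx_id // eq_sym; exact: eqP.
Qed.

Lemma innovation_pdmx (R : realType) n l (C : 'M[R]_(l, n)) (V : 'M[R]_l)
    (Pi : 'M[R]_n) : psdmx Pi -> pdmx V -> pdmx (C *m Pi *m C^T + V).
Proof.
case=> /symmetricmx_tr sPi Pi_ge0 [/symmetricmx_tr sV V_gt0].
split=> [|x x0].
  apply/symmetricmx_tr.
  by rewrite linearD /= !trmx_mul trmxK mulmxA sPi sV.
rewrite mulmxDr mulmxDl mxE ltr_wpDl ?V_gt0 //.
(* The form of [C *m Pi *m C^T] at [x] is that of [Pi] at [C^T *m x]. *)
by have := Pi_ge0 (C^T *m x); rewrite trmx_mul trmxK !mulmxA.
Qed.

(** Since [V *m invmx M] is invertible, [CL] shows that a kernel vector [x] satisfies [C *m x = 0];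
    on such vectors the update is the identity, so [x = 0]. *)
Lemma kalman_update_unit (R : realType) n l (C : 'M[R]_(l, n)) (V : 'M[R]_l)
    (Pi : 'M[R]_n) :
  psdmx Pi -> pdmx V -> 1%:M - kalman_gain C V Pi *m C \in unitmx.
Proof.
move=> Pi_psd V_pd; set M := C *m Pi *m C^T + V.
have Mu : M \in unitmx by apply/pdmx_unit/innovation_pdmx.
have CL : C *m (1%:M - kalman_gain C V Pi *m C) = V *m invmx M *m C.
  rewrite mulmxBr mulmx1 /kalman_gain -/M !mulmxA.
  (* This turns [C] times the gain into [1 - V *m invmx M]. *)
  have -> : C *m Pi *m C^T = M - V by rewrite addrK.
  by rewrite mulmxBl mulmxV // mulmxBl mul1mx opprB addrC subrK.
apply: unitmx_inj => x Ix0.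
have Cx0 : C *m x = 0.
  have VMu : V *m invmx M \in unitmx by rewrite unitmx_mul pdmx_unit ?unitmx_inv.
  by rewrite -[C *m x](mulKmx VMu) (mulmxA _ C) -CL -mulmxA Ix0 !mulmx0.
by move: Ix0; rewrite mulmxBl mul1mx -mulmxA Cx0 mulmx0 subr0.
Qed.

Lemma mxrow_eq0P (V : nmodType) n m (q_ : 'I_n -> nat)
    (B_ : forall j, 'M[V]_(m, q_ j)) :
  \mxrow_j B_ j = 0 <-> forall j, B_ j = 0.
Proof. by rewrite -[0 in X in X <-> _]mxrow0; split=> /eq_mxrowP. Qed.

Lemma controllable_inj (R : realType) n p (A : 'M[R]_n) (B : 'M[R]_(n, p))
    (x : 'rV_n) :
  controllable A B -> (forall k : 'I_n, x *m A ^+ k *m B = 0) -> x = 0.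
Proof.
move=> /eqP ctrl xAB0; apply: (row_free_inj ctrl).
by rewrite mul0mx mul_mxrow; apply/mxrow_eq0P => k; rewrite mulmxA.
Qed.

Lemma observable_inj (R : realType) n p (A : 'M[R]_n) (C : 'M[R]_(p, n))
    (x : 'cV_n) :
  observable A C -> (forall k : 'I_n, C *m A ^+ k *m x = 0) -> x = 0.
Proof.
move=> /eqP obs CAx0; have /row_fullP[D DO1] := obs.
rewrite -[x]mul1mx -DO1 -mulmxA mxcol_mul.
by under eq_mxcol => k do rewrite CAx0; rewrite mxcol0 mulmx0.
Qed.

(** Removes the casts, so that the block product lemmas apply to [kron_id]. *)
Lemma kron_idE (R : realType) n (a : 'rV[R]_n) p :
  kron_id a p = \mxrow_(j < n) (a 0 j *: (1%:M : 'M_p)).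
Proof.
apply/mxrowP => j; rewrite mxrowK; apply/matrixP => i k.
rewrite mxE castmxE /=.
have -> : cast_ord (esym (mul1n p)) i = mxtens_index (0 : 'I_1, i).
  exact: val_inj.
have -> : cast_ord (esym (sum_ord_const n p)) (tagnat.Rank j k)
          = mxtens_index (j, k).
  (* Both sides are the flat position [j * p + k]; on the left, [j * p] appears as the total size of
     the blocks before [j]. *)
  apply: val_inj; rewrite [LHS]tagnat.RankEsum; congr (_ + _)%N.
  rewrite -(big_ord_widen n (fun=> p) (ltnW (ltn_ord j))).
  by rewrite -sum_ord_const.
by rewrite tensmxE !mxE.
Qed.

Lemma kron_id_toeplitz (R : realType) n p (E : 'M[R]_n) (F : 'M[R]_(n, p))
    (a : 'rV[R]_n) :
  kron_id a n *m toeplitz_mx E F =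
  \mxrow_(j < n) \sum_(i < n | (j < i)%N) a 0 i *: (E ^+ (i - j - 1) *m F).
Proof.
rewrite kron_idE mul_mxrow_mxblock; apply: eq_mxrow => j.
rewrite [RHS]big_mkcond; apply: eq_bigr => i _.
by case: ifP => _; rewrite ?mulmx0 // -scalemxAl mul1mx.
Qed.

(** Block [j = n - 1 - k] of the hypothesis expresses [x *m E ^+ k *m G] as the sum over [i > j] of
    [a 0 i] times [x *m E ^+ (i - j - 1) *m G]. Since [i <= n - 1], these exponents are below [k],
    and strong induction on [k] applies. *)
Lemma markov_row_inj (R : realType) n p (E : 'M[R]_n) (G : 'M[R]_(n, p))
    (a : 'rV[R]_n) (x : 'rV_n) :
  controllable E G ->
  x *m (input_row E G - kron_id a n *m toeplitz_mx E G) = 0 -> x = 0.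
Proof.
move=> ctrl; rewrite kron_id_toeplitz -mxrowB mul_mxrow.
move/mxrow_eq0P => xP0; apply: (controllable_inj ctrl).
suff xE0 k : (k < n)%N -> x *m E ^+ k *m G = 0 by move=> k; apply: xE0.
elim/ltn_ind: k => k IHk ltkn.
have ltjn : (n - 1 - k < n)%N by rewrite -subnDA ltn_subrL add1n (leq_ltn_trans _ ltkn).
have := xP0 (Ordinal ltjn); rewrite /= subKn; last by rewrite subn1 -ltnS (ltn_predK ltkn).
rewrite mulmxBr -mulmxA => /eqP; rewrite subr_eq0 => /eqP ->.
rewrite mulmx_sumr big1 // => i lt_ji.
rewrite -scalemxAr mulmxA IHk ?scaler0 //.
  move: lt_ji (ltn_ord i) ltkn; rewrite -!subnDA; lia.
by rewrite -subnDA (leq_ltn_trans (leq_subr _ _)).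
Qed.

(** The gain is taken in the form [X *m A] because both it and every positive power of [E] then end
    with a factor [A], and so kill the kernel of [A]. *)
Lemma lqg_controller_unit (R : realType) n m l (hm : (0 < m)%N)
    (A : 'M[R]_n) (C : 'M[R]_(l, n)) (L : 'M[R]_(n, l)) (X : 'M[R]_(m, n))
    (E := (1%:M - L *m C) *m A) :
  1%:M - L *m C \in unitmx ->
  (forall i : 'I_m, observable E (row i (X *m A))) -> E \in unitmx.
Proof.
move=> Iu obs; rewrite unitmx_mul Iu; apply: unitmx_inj => v Av0.
(* One observable row is enough; [hm] provides row 0. *)
apply: (observable_inj (obs (Ordinal hm))) => -[[|k] ltkn] /=.
  by rewrite expr0 mulmx1 -row_mul -mulmxA Av0 mulmx0 row0.
by rewrite exprSr -mulmxE -!mulmxA Av0 !mulmx0.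
Qed.

Theorem mainTheorem5 (R : realType) (n m l : nat)
  (hn : (0 < n)%N) (hm : (0 < m)%N) (hl : (0 < l)%N)
  (A : 'M[R]_n) (B : 'M[R]_(n, m)) (C : 'M[R]_(l, n))
  (W : 'M[R]_n) (V : 'M[R]_l) (Q : 'M[R]_n) (Ru : 'M[R]_m)
  (hW : psdmx W) (hV : pdmx V) (hQ : psdmx Q) (hRu : pdmx Ru)
  (Wh Qh : 'M[R]_n) (hWh : is_psd_sqrt W Wh) (hQh : is_psd_sqrt Q Qh)
  (hAB : controllable A B) (hAW : controllable A Wh)
  (hAC : observable A C) (hAQ : observable A Qh)
  (Pi S : 'M[R]_n)
  (hPi : stabilizing_filter_riccati A C W V Pi)
  (hS : stabilizing_control_riccati A B Q Ru S)
  (Lf : 'M[R]_(n, l)) (hLf : Lf = kalman_gain C V Pi)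
  (K : 'M[R]_(m, n)) (hK : K = lqr_gain A B Ru S)
  (E : 'M[R]_n) (hE : E = (1%:M - Lf *m C) *m A)
  (F : 'M[R]_(n, m)) (hF : F = (1%:M - Lf *m C) *m B)
  (G : 'M[R]_(n, l)) (hG : G = Lf)
  (hEK : forall i : 'I_m, observable E (row i K))
  (hEL : controllable E Lf)
  (a : 'rV[R]_n) (ha : E ^+ n = \sum_(k < n) a 0 k *: E ^+ k) :
  \rank (est_mx E F G a) = (n + m)%N.
Proof.
have Eu : E \in unitmx.
  have [Pi_psd _ _] := hPi.
  (* [X] is the LQR gain without its last factor [A]. *)
  rewrite hE; apply: (lqg_controller_unit hm (X :=
    - (invmx (Ru + B^T *m S *m B) *m B^T *m S))).
    by rewrite hLf kalman_update_unit.
  by move=> i; rewrite -hE mulNmx -/(lqr_gain A B Ru S) -hK.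
apply/eqP/inj_row_free => v; rewrite -[v]hsubmxK.
move: (lsubmx v) (rsubmx v) => x y.
(* The zero block makes [xG0] a condition on [x] alone. *)
rewrite /est_mx mul_row_block mulmx0 addr0 -row_mx0 => /eq_row_mx[xy0 xG0].
have x0 : x = 0 by apply: markov_row_inj xG0; rewrite hG.
move: xy0; rewrite x0 mul0mx add0r kron_idE mul_mxrow.
move/mxrow_eq0P => ya0.
suff -> : y = 0 by rewrite row_mx0.
apply/eqP/negPn/negP => y_neq0.
have a0 k : a 0 k = 0.
  have /eqP := ya0 k.
  by rewrite -scalemxAr mulmx1 scaler_eq0 (negPf y_neq0) orbF => /eqP.
have Enu k : E ^+ k \in unitmx.
  by elim: k => [|k IHk]; rewrite ?expr0 ?unitmx1 // exprS -mulmxE unitmx_mul Eu.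
have En0 : E ^+ n = 0 by rewrite ha big1 // => k _; rewrite a0 scale0r.
(* The zero matrix is invertible only in size 0, which [hn] excludes. *)
have := Enu n; rewrite En0 -row_free_unit /row_free mxrank0.
by rewrite eq_sym -[_ == _]negbK -lt0n hn.
Qed.
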